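(* Suppose the strong regularity assumption (stated in the context) holds, let $\hat w\in\mathcal F$, and let $d\in\mathbb N$, $d\ge1$. Then there exist $L,\Delta>0$ such that the following holds for the AA($d$)-inner iterations at $\hat w$ with depth $d$ and trust-region radius $\Delta$. If the least-squares coefficients $\gamma_l$ are uniformly bounded, i.e., there exists $D>0$ such that $\Vert\gamma_l\Vert_\infty\le D$ for all $l\in\{2,3,\dots\}$, then the iterates $w_l$ produced by the AA($d$)-inner iterations converge linearly, in the sense that $$\Vert w_{l+1}-w^*\Vert\le L\Delta\,\bar D\sum_{j=l-d}^{l}\Vert w_j-w^*\Vert\qquad\text{for } l\ge d,$$ where $\bar D:=\max\{2D,\,1+D\}$ and $w^*\in\mathcal F$ is the limit point of the unaccelerated inner iterations at $\hat w$ with the same radius $\Delta$.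
   Context: **Problem.** Let $c\in\mathbb R^{n_w}$, $b\in\mathbb R^{n_b}$, $A\in\mathbb R^{n_b\times n_w}$ with full row rank $n_b$, $C\in\mathbb R^{n_g\times n_w}$, and let $g:\mathbb R^{n_y}\to\mathbb R^{n_g}$ be twice continuously differentiable. $P_y\in\mathbb R^{n_y\times n_w}$ is a selection matrix: each row has a single entry equal to 1 (other entries 0), and it selects the variables of $w$ that enter the constraints nonlinearly. The nonlinear program is $$\min_{w\in\mathbb R^{n_w}} c^\top w\quad\text{s.t.}\quad Cw+g(P_yw)=0,\quad Aw+b\le 0,$$ with feasible set $\mathcal F=\{w\in\mathbb R^{n_w}: Cw+g(P_yw)=0,\ Aw+b\le0\}$. The infeasibility measure is $h(w)=\Vert Cw+g(P_yw)\Vert_\infty+\Vert[Aw+b]^+\Vert_\infty$, where $[\cdot]^+$ is the componentwise positive part. **Notation.** $\Vert\cdot\Vert$ is the Euclidean norm. $\mathcal B(\hat w,\gamma)$ is the closed Euclidean ball, $\mathcal B_\infty(\hat w,\Delta)=\{w:\Vert w-\hat w\Vert_\infty\le\Delta\}$, and $\Pi_S$ is the Euclidean projection onto a nonempty closed convex set $S$. **Parametric LP.** For $\hat w\in\mathcal F$, let $G^\top=\nabla g(P_y\hat w)^\top P_y$ (where $\nabla g(\cdot)^\top$ is the Jacobian of $g$) and $$\delta(w_l,\hat w)=g(P_yw_l)-g(P_y\hat w)-G^\top(w_l-\hat w),\qquad \delta_l=\delta(w_l,\hat w).$$ For $\Delta>0$, $\mathrm{PLP}(w_l;\hat w,\Delta)$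 is the linear program $$\min_{w\in\mathbb R^{n_w}} c^\top w\ \text{ s.t. }\ \delta_l+Cw+g(P_y\hat w)+G^\top(w-\hat w)=0,\ \ Aw+b\le0,\ \ \Vert P_y(w-\hat w)\Vert_\infty\le\Delta,$$ whose solution is denoted $w_{\mathrm{PLP}}^*(w_l;\hat w,\Delta)$. Write $\bar w=w_{\mathrm{PLP}}^*(\hat w;\hat w,\Delta)$. **Strong regularity assumption.** For all $\hat w\in\mathcal F$ there exist $L_1,L_2,\bar\Delta>0$ such that for all $w_1,w_2\in\mathcal B_\infty(\hat w,\Delta)$ with $\Delta\le\bar\Delta$, and with $\delta_i=\delta(w_i,\hat w)\in\mathcal B(0,L_2\Delta)$, $i=1,2$, it holds that $\Vert w_{\mathrm{PLP}}^*(w_1;\hat w,\Delta)-w_{\mathrm{PLP}}^*(w_2;\hat w,\Delta)\Vert\le L_1\Vert\delta_1-\delta_2\Vert$. **Unaccelerated inner iterations and $w^*$.** These start at $w_0=\bar w$ and set $w_{l+1}=w_{\mathrm{PLP}}^*(w_l;\hat w,\Delta)$. It is a known result that, for $\hat w\in\mathcal F$ and under the strong regularity assumption, there exist $\Delta_{\max,1},L>0$ such that for all $\Delta\le\Delta_{\max,1}$ one has $L\Delta\le1$ and these iterates converge to a point $w^*\in\mathcal F$ with $\Vert w_{l+1}-w^*\Vert\le L\Delta\Vert w_l-w^*\Vert$. The point $w^*$ is a fixed point: $w^*=w_{\mathrm{PLP}}^*(w^*;\hat w,\Delta)$. The radius $\Delta$ in the claim is understood to be one for which $w^*$ exists. **AA($d$)-inner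 iterations.** Given $\hat w\in\mathcal F$, $\Delta>0$, memory depth $d$ and a tolerance $\sigma_{\mathrm{inner}}\in(0,10^{-5})$, set $w_0=\hat w$, $w_1=\bar w$, $r_1=w_1-w_0$. For $l=1,2,\dots$: let $m=\min\{l,d\}$; stop and return $w_l$ if $h(w_l)\le\sigma_{\mathrm{inner}}$ and $\Vert\bar w-w_l\Vert/\Vert\bar w-\hat w\Vert<1/2$ (one also stops if the iterates are diverging); otherwise set - $r_{l+1}=w_{\mathrm{PLP}}^*(w_l;\hat w,\Delta)-w_l$, - $F_l=\big((r_{l+1}-r_l)\ \cdots\ (r_{l-m+2}-r_{l-m+1})\big)\in\mathbb R^{n_w\times m}$ and $E_l=\big((w_l-w_{l-1})\ \cdots\ (w_{l-m+1}-w_{l-m})\big)\in\mathbb R^{n_w\times m}$, - $\gamma_{l+1}\in\operatorname{argmin}_{\gamma\in\mathbb R^m}\Vert r_{l+1}-F_l\gamma\Vert$, - $w_{l+1}=\Pi_{\mathcal B_\infty(\hat w,\Delta)}\big(w_l+r_{l+1}-(E_l+F_l)\gamma_{l+1}\big)$. Statements about the iterates and the $\gamma_l$ concern those indices for which they are produced. *)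

(* Defs.v *)
From HB Require Import structures.
From mathcomp Require Import all_boot all_order all_algebra.
From mathcomp Require Import all_classical all_reals all_analysis.

Set Implicit Arguments.
Unset Strict Implicit.
Unset Printing Implicit Defensive.

Import Order.TTheory GRing.Theory Num.Theory.
Import numFieldNormedType.Exports.

Local Open Scope classical_set_scope.
Local Open Scope ring_scope.

(* On matrices the library norm `|v| is the maximum norm, so `|v| is the
   infinity norm of a column vector; the Euclidean norm is defined here. *)
Definition enorm (R : realType) (n : nat) (v : 'cV[R]_n) : R :=
  Num.sqrt (\sum_i v i 0 ^+ 2).

Definition Binf (R : realType) (n : nat) (x : 'cV[R]_n) (Delta : R) :
    set 'cV[R]_n :=
  [set w | `|w - x| <= Delta].

Definition is_proj (R : realType) (n : nat) (S : set 'cV[R]_n)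
    (x p : 'cV[R]_n) : Prop :=
  S p /\ forall q, S q -> enorm (x - p) <= enorm (x - q).

Definition lev (R : realType) (n : nat) (u v : 'cV[R]_n) : Prop :=
  forall i, u i 0 <= v i 0.

Definition pos_part (R : realType) (n : nat) (v : 'cV[R]_n) : 'cV[R]_n :=
  \col_i Num.max (v i 0) 0.

(* Entry (i, j) is the partial derivative of the i-th component with respect
   to the j-th variable (the library's 'J acts on row vectors and is the
   transpose of this matrix). *)
Definition jac (R : realType) (n m : nat) (g : 'cV[R]_n -> 'cV[R]_m)
    (y : 'cV[R]_n) : 'M[R]_(m, n) :=
  \matrix_(i, j) ('D_(delta_mx j 0) g y) i 0.

Definition twice_cont_diff (R : realType) (n m : nat)
    (g : 'cV[R]_n -> 'cV[R]_m) : Prop :=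
  [/\ forall y, differentiable g y,
      forall y, differentiable (jac g) y &
      forall v, continuous (fun y => 'D_v (jac g) y)].

Definition selection_mx (R : realType) (m n : nat) (P : 'M[R]_(m, n)) : Prop :=
  forall i, exists j, forall k, P i k = (k == j)%:R.

Record nlp (R : realType) (nw nb ng ny : nat) := Nlp {
  cost : 'cV[R]_nw;
  Aineq : 'M[R]_(nb, nw);
  bineq : 'cV[R]_nb;
  Ceq : 'M[R]_(ng, nw);
  gfun : 'cV[R]_ny -> 'cV[R]_ng;
  Py : 'M[R]_(ny, nw);
  Aineq_rank : \rank Aineq = nb;
  gfun_C2 : twice_cont_diff gfun;
  Py_selection : selection_mx Py
}.

Section NLP.
Context {R : realType} {nw nb ng ny : nat} (P : nlp R nw nb ng ny).
Implicit Types (w wl what : 'cV[R]_nw) (Delta : R).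

Definition objective w : R := ((cost P)^T *m w) 0 0.
Definition eq_residual w : 'cV[R]_ng := Ceq P *m w + gfun P (Py P *m w).
Definition ineq_value w : 'cV[R]_nb := Aineq P *m w + bineq P.

Definition feasible : set 'cV[R]_nw :=
  [set w | eq_residual w = 0 /\ lev (ineq_value w) 0].

Definition infeasibility w : R :=
  `|eq_residual w| + `|pos_part (ineq_value w)|.

Definition Gtr what : 'M[R]_(ng, nw) := jac (gfun P) (Py P *m what) *m Py P.

Definition delta wl what : 'cV[R]_ng :=
  gfun P (Py P *m wl) - gfun P (Py P *m what) - Gtr what *m (wl - what).

Definition plp_feasible wl what Delta : set 'cV[R]_nw :=
  [set w | [/\ delta wl what + Ceq P *m w + gfun P (Py P *m what)
                 + Gtr what *m (w - what) = 0,
               lev (ineq_value w) 0 &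
               `|Py P *m (w - what)| <= Delta]].

Definition plp_solutions wl what Delta : set 'cV[R]_nw :=
  [set w | plp_feasible wl what Delta w /\
     forall v, plp_feasible wl what Delta v -> objective w <= objective v].

(* "The" solution of the linear program: the unique one when there is only one,
   otherwise a choice that depends only on the solution set (and 0 when there
   is no solution). *)
Definition wPLP wl what Delta : 'cV[R]_nw :=
  xget 0 (plp_solutions wl what Delta).

Definition wbar what Delta : 'cV[R]_nw := wPLP what what Delta.

(* Speaking of the solutions of the two programs presupposes that they exist,
   so solvability is part of the assumption; without it the values of [wPLP]
   would be meaningless. *)
Definition strong_regularity : Prop :=
  forall what, feasible what ->
  exists L1 L2 Dbar : R,
    [/\ 0 < L1, 0 < L2, 0 < Dbar &
     forall Delta w1 w2, 0 < Delta -> Delta <= Dbar ->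
       Binf what Delta w1 -> Binf what Delta w2 ->
       enorm (delta w1 what) <= L2 * Delta ->
       enorm (delta w2 what) <= L2 * Delta ->
       [/\ plp_solutions w1 what Delta !=set0,
           plp_solutions w2 what Delta !=set0 &
           enorm (wPLP w1 what Delta - wPLP w2 what Delta)
             <= L1 * enorm (delta w1 what - delta w2 what)]].

Definition inner_iter what Delta (l : nat) : 'cV[R]_nw :=
  iter l (fun w => wPLP w what Delta) (wbar what Delta).

Definition aa_stop what Delta (sigma : R) w : Prop :=
  infeasibility w <= sigma /\
  enorm (wbar what Delta - w) / enorm (wbar what Delta - what) < 1 / 2.

End NLP.

(* Columns j = 0, ..., m - 1 of the difference matrices, m = min(l, d). *)
Definition Fmx (R : realType) (n d : nat) (r : nat -> 'cV[R]_n) (l : nat) :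
    'M[R]_(n, minn l d) :=
  \matrix_(i, j) (r (l - j).+1 - r (l - j)%N) i 0.

Definition Emx (R : realType) (n d : nat) (w : nat -> 'cV[R]_n) (l : nat) :
    'M[R]_(n, minn l d) :=
  \matrix_(i, j) (w (l - j)%N - w (l - j.+1)%N) i 0.

(* [last] is the index of the last iterate produced, [None] meaning that the
   iteration never stops. *)
Definition produced (last : option nat) (l : nat) : bool :=
  if last is Some n then (l <= n)%N else true.

(* The coefficient vector gam l.+1 computed from w l has min(l, d) entries.
   Since w l.+1 is produced only if w l does not pass the stopping test, while
   [last] is otherwise arbitrary, a run may also be broken off at any point, in
   particular when the iterates are found to diverge. *)
Record aa_run (R : realType) (nw nb ng ny : nat) (P : nlp R nw nb ng ny)
    (d : nat) (what : 'cV[R]_nw) (Delta sigma : R) (last : option nat)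
    (w r : nat -> 'cV[R]_nw)
    (gam : forall l : nat, 'cV[R]_(minn l.-1 d)) : Prop := AARun {
  aa_w0 : w 0%N = what;
  aa_w1 : w 1%N = wbar P what Delta;
  aa_r1 : r 1%N = w 1%N - w 0%N;
  aa_continue : forall l, (1 <= l)%N -> produced last l.+1 ->
    ~ aa_stop P what Delta sigma (w l);
  aa_residual : forall l, (1 <= l)%N -> produced last l.+1 ->
    r l.+1 = wPLP P (w l) what Delta - w l;
  aa_lsq : forall l, (1 <= l)%N -> produced last l.+1 ->
    forall x : 'cV[R]_(minn l d),
      enorm (r l.+1 - Fmx d r l *m gam l.+1)
        <= enorm (r l.+1 - Fmx d r l *m x);
  aa_update : forall l, (1 <= l)%N -> produced last l.+1 ->
    is_proj (Binf what Delta)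
      (w l + r l.+1 - (Emx d w l + Fmx d r l) *m gam l.+1) (w l.+1)
}.

(* Main.v *)
Require Import Defs.
From HB Require Import structures.
From mathcomp Require Import all_boot all_order all_algebra.
From mathcomp Require Import all_classical all_reals all_analysis.
From mathcomp Require Import ring lra zify.

Import Order.TTheory GRing.Theory Num.Theory.
Import numFieldNormedType.Exports.

Local Open Scope classical_set_scope.
Local Open Scope ring_scope.

Set Implicit Arguments.
Unset Strict Implicit.

(** Write Phi(w) for the solution of the parametric linear program at w. The
    parameter w enters that program only through
    delta(w) = g(Py w) - g(Py what) - G^T (w - what), hence only through Py w.
    Since g is C^1, delta is Lipschitz in Py w near what, with a constant as
    small as desired ([jac_strictly_differentiable]). Combined with strong
    regularity this makes Phi a contraction of ratio 1/2 of the slab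
    |Py (w - what)| <= Delta into itself for some Delta > 0
    ([wPLP_contraction]). The unaccelerated iteration therefore converges to
    a fixed point w*, by Banach's theorem ([inner_iter_cvg]), and a fixed
    point of Phi satisfies the original constraints, because linearization and
    correction cancel ([plp_fixed_point_feasible]).

    An Anderson step replaces Phi(w_l) by
    Phi(w_l) - sum_(j < d) gamma_j (Phi(w_(l-j)) - Phi(w_(l-j-1))), as the
    columns of E + F are differences of consecutive values w_k + r_(k+1) =
    Phi(w_k). Subtracting w* and using the contraction bounds the error by the
    sum of the earlier errors; collecting the weight of each of them gives the
    factor max(2D, 1 + D) ([anderson_weights_le], [anderson_step_le]).

    It remains to project on the box |w - what| <= Delta. If w* is in the box,
    the projection costs a constant factor only ([is_proj_norm_le]). The
    linear programs restrict just the components Py w, so w* may also lie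
    outside the box. In that case the iterates, which are projected on the
    box, stay at a positive distance from w* and the estimate holds because
    its left side is bounded and its right side bounded away from 0, with a
    factor L that depends on this distance.

    All estimates are made in the maximum norm; the passage to the Euclidean
    norm costs factors sqrt n, which are absorbed by L or by the choice of
    Delta. *)

(** * Maximum norm and Euclidean norm *)

(** Matrices carry both a norm and a complete uniform structure; the join of
    the two is what Banach's fixed point theorem asks for. *)
HB.instance Definition _ (R : realType) (m n : nat) := Complete.on 'M[R]_(m, n).

Lemma ler_coord_norm (R : realType) (m n : nat) (M : 'M[R]_(m, n)) i j :
  `|M i j| <= `|M|.
Proof.
rewrite [leRHS]/Num.Def.normr/= mx_normrE.
exact: (le_bigmax _ (fun ij : 'I_m * 'I_n => `|M ij.1 ij.2|) (i, j)).
Qed.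

Lemma norm_le_coord (R : realType) (m n : nat) (M : 'M[R]_(m, n)) (c : R) :
  0 <= c -> (forall i j, `|M i j| <= c) -> `|M| <= c.
Proof.
move=> c0 Mc; rewrite [leLHS]/Num.Def.normr/= mx_normrE.
by apply: bigmax_le => // -[i j] _ /=.
Qed.

Lemma norm_le_enorm (R : realType) (n : nat) (v : 'cV[R]_n) : `|v| <= enorm v.
Proof.
apply: norm_le_coord; first exact: sqrtr_ge0.
move=> i j; rewrite ord1 -sqrtr_sqr ler_wsqrtr// (bigD1 i)//= lerDl.
by apply: sumr_ge0 => k _; exact: sqr_ge0.
Qed.

Lemma enorm_le_norm (R : realType) (n : nat) (v : 'cV[R]_n) :
  enorm v <= Num.sqrt n%:R * `|v|.
Proof.
rewrite -[X in _ * X]normr_id -sqrtr_sqr -sqrtrM ?ler0n// ler_wsqrtr//.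
rewrite (_ : n%:R * _ = \sum_(i < n) `|v| ^+ 2); last first.
  by rewrite sumr_const card_ord mulr_natl.
apply: ler_sum => i _; rewrite -real_normK ?num_real//.
by rewrite lerXn2r ?nnegrE//; exact: ler_coord_norm.
Qed.

Lemma norm_mulmx_le (R : realType) (m n : nat) (M : 'M[R]_(m, n))
    (v : 'cV[R]_n) :
  `|M *m v| <= n%:R * (`|M| * `|v|).
Proof.
apply: norm_le_coord => [|i j]; first by rewrite !mulr_ge0.
rewrite mxE (le_trans (ler_norm_sum _ _ _))//.
rewrite (_ : n%:R * _ = \sum_(k < n) `|M| * `|v|); last first.
  by rewrite sumr_const card_ord mulr_natl.
by apply: ler_sum => k _; rewrite normrM ler_pM// ler_coord_norm.
Qed.

(** * Strict differentiability *)

Lemma is_derive_line (R : realType) (V W : normedModType R) (f : V -> W)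
    (x v : V) (t : R) (df : W) :
  is_derive (x + t *: v) v f df ->
  is_derive t 1 (fun s : R => f (x + s *: v)) df.
Proof.
move=> [fd fE].
have E : (fun h => h^-1 *: (f (x + (h *: 1 + t) *: v) - f (x + t *: v))) =
         (fun h => h^-1 *: (f (h *: v + (x + t *: v)) - f (x + t *: v))).
  apply/funext => h.
  by rewrite scalerDl addrCA [h *: 1](mulr1 h).
by split; [rewrite /derivable /= E|rewrite /derive /= E].
Qed.

Lemma derive_jac (R : realType) (n m : nat) (g : 'cV[R]_n -> 'cV[R]_m)
    (y v : 'cV[R]_n) :
  differentiable g y -> 'D_v g y = jac g y *m v.
Proof.
move=> gd; rewrite deriveE// {1}[v]matrix_sum_delta linear_sum/=.
apply/colP => i; rewrite summxE mxE; apply: eq_bigr => j _.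
by rewrite big_ord1 linearZ/= !mxE -deriveE// mulrC.
Qed.

(** The mean value theorem, applied to each component of g along the segment
    from y2 to y1, turns the increment of g into the Jacobian at a point of the
    segment, which continuity makes close to the Jacobian at y0. *)
Lemma jac_strictly_differentiable (R : realType) (n m : nat)
    (g : 'cV[R]_n -> 'cV[R]_m) (y0 : 'cV[R]_n) (e : R) :
  (forall y, differentiable g y) -> {for y0, continuous (jac g)} -> 0 < e ->
  exists2 rho : R, 0 < rho & forall y1 y2,
    `|y1 - y0| <= rho -> `|y2 - y0| <= rho ->
    `|g y1 - g y2 - jac g y0 *m (y1 - y2)| <= e * `|y1 - y2|.
Proof.
move=> gd gc e0.
(* The product of a matrix with n columns and a vector costs a factor n in the
   maximum norm; n + 1 avoids dividing by 0 in dimension 0. *)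
pose e' := e / n.+1%:R.
have e'0 : 0 < e' by rewrite divr_gt0.
have /cvgrPdist_le/(_ e' e'0)/nbhs_ballP[r /= r0 rP] := gc.
exists (r / 2) => [|y1 y2 y1r y2r]; first by rewrite divr_gt0.
apply: norm_le_coord => [|i j]; first by rewrite mulr_ge0// ltW.
rewrite ord1.
set v := y1 - y2.
pose phi (t : R) := g (y2 + t *: v) i 0.
have phid (t : R) :
    is_derive t 1 (phi : R -> R) ((jac g (y2 + t *: v) *m v) i 0).
  apply: (is_derive_line (f := fun y => g y i 0)).
  have gD : derivable g (y2 + t *: v) v by exact: diff_derivable.
  split; first exact: (derivable_mxP _ _ _).1.
  by rewrite -derive_jac// derive_mx// mxE.
have phic : {within `[0, 1], continuous phi}.
  apply: continuous_subspaceT => t.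
  by apply/differentiable_continuous/derivable1_diffP; case: (phid t).
have [c] := MVT (@ltr01 R) (fun x _ => phid x) phic.
rewrite in_itv/= => /andP[c0 c1].
rewrite subr0 mulr1 /phi scale1r scale0r addr0 [y2 + v]addrC subrK => E.
have -> : (g y1 - g y2 - jac g y0 *m v) i 0 =
    ((jac g (y2 + c *: v) - jac g y0) *m v) i 0.
  by rewrite mulmxBl !mxE [in LHS]E !mxE.
rewrite (le_trans (ler_coord_norm _ _ _))// (le_trans (norm_mulmx_le _ _))//.
have yc : `|jac g y0 - jac g (y2 + c *: v)| <= e'.
  apply: rP; rewrite -ball_normE/= distrC.
  have -> : y2 + c *: v - y0 = c *: (y1 - y0) + (1 - c) *: (y2 - y0).
    by apply/matrixP => a b; rewrite !mxE; lra.
  rewrite (le_lt_trans (ler_normD _ _))// !normrZ !ger0_norm ?subr_ge0 ?ltW//.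
  have := ler_wpM2l (ltW c0) y1r.
  have c1' : 0 <= 1 - c by rewrite subr_ge0 ltW.
  have := ler_wpM2l c1' y2r.
  lra.
rewrite mulrA ler_wpM2r// distrC (le_trans (ler_wpM2l _ yc))//.
rewrite /e' mulrCA ler_piMr ?(ltW e0)//.
by rewrite ler_pdivrMr// mul1r ler_nat.
Qed.

(** * Selection matrices *)

Lemma selection_mulmx_le (R : realType) (m n : nat) (S : 'M[R]_(m, n))
    (v : 'cV[R]_n) :
  selection_mx S -> `|S *m v| <= `|v|.
Proof.
move=> selS; apply: norm_le_coord => // i j; have [k Sik] := selS i.
rewrite mxE (bigD1 k)//= big1 => [|l lk]; last by rewrite Sik (negbTE lk) mul0r.
by rewrite Sik eqxx mul1r addr0 ler_coord_norm.
Qed.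

(** The components of v that are not selected can be reset to those of x. This
    moves a point of the slab defined by the selected components into the box
    around x, without changing what the selection sees. *)
Lemma selection_truncate (R : realType) (m n : nat) (S : 'M[R]_(m, n))
    (x v : 'cV[R]_n) :
  selection_mx S -> exists2 v', S *m v' = S *m v & `|v' - x| <= `|S *m (v - x)|.
Proof.
move=> selS.
exists (\col_k if [exists i, S i k == 1] then v k 0 else x k 0).
  apply/matrixP => i j; rewrite !mxE; apply: eq_bigr => k _.
  rewrite !mxE ord1; case: ifPn => // /existsPn /(_ i).
  have [l Sil] := selS i.
  by rewrite Sil; case: (k == l); rewrite ?eqxx// !mul0r.
apply: norm_le_coord => // k j; rewrite !mxE ord1.
case: ifPn => [/existsP[i /eqP Sik]|_]; last by rewrite subrr normr0.
have [l Sil] := selS i.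
have kl : k = l.
  apply/eqP; move: Sik.
  by rewrite Sil; case: (k == l) => // /esym/eqP; rewrite oner_eq0.
apply: le_trans (ler_coord_norm _ i 0).
rewrite mxE (bigD1 k)//= big1 => [|p pk]; last first.
  by rewrite Sil -kl (negbTE pk) mul0r.
by rewrite Sik mul1r addr0 !mxE.
Qed.

(** * The parametric linear program as a contraction *)

(** The trust region of the linear programs, hence stable under the solution
    map, whereas the box of radius Delta is in general not. *)
Definition Py_slab (R : realType) (nw nb ng ny : nat) (P : nlp R nw nb ng ny)
    (what : 'cV[R]_nw) (Delta : R) : set 'cV[R]_nw :=
  [set w | `|Py P *m (w - what)| <= Delta].

Section InnerProblem.
Context {R : realType} {nw nb ng ny : nat} (P : nlp R nw nb ng ny).
Implicit Types (w what : 'cV[R]_nw) (Delta : R).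

Lemma delta_sub w1 w2 what :
  delta P w1 what - delta P w2 what =
  gfun P (Py P *m w1) - gfun P (Py P *m w2)
    - jac (gfun P) (Py P *m what) *m (Py P *m w1 - Py P *m w2).
Proof.
rewrite /delta /Gtr -!mulmxA !mulmxBr.
by apply/matrixP => i j; rewrite !mxE; lra.
Qed.

Lemma delta_self what : delta P what what = 0.
Proof. by rewrite /delta !subrr mulmx0 subrr. Qed.

(** Strong regularity speaks of parameters in the box only; with
    [selection_truncate], this carries it over to the slab. *)
Lemma wPLP_Py w1 w2 what Delta : Py P *m w1 = Py P *m w2 ->
  delta P w1 what = delta P w2 what /\
  wPLP P w1 what Delta = wPLP P w2 what Delta.
Proof.
move=> E.
have dE : delta P w1 what = delta P w2 what.
  by apply/eqP; rewrite -subr_eq0 delta_sub E !subrr mulmx0 subrr.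
split; first exact: dE.
by rewrite /wPLP /plp_solutions /plp_feasible dE.
Qed.

Lemma Binf_Py_slab what Delta : Binf what Delta `<=` Py_slab P what Delta.
Proof.
by move=> w; apply: le_trans; exact: selection_mulmx_le (Py_selection P).
Qed.

Lemma closed_Py_slab what Delta : closed (Py_slab P what Delta).
Proof.
pose f w := `|Py P *m (w - what)|.
have fc : continuous f.
  move=> x; apply/(@cvgrPdist_le _ _ _ _ (nbhs_filter x)) => e e0.
  apply/nbhs_ballP; exists e => //= y; rewrite -ball_normE/= => /ltW xy.
  rewrite (le_trans (ler_dist_dist _ _))// -mulmxBr.
  rewrite (le_trans (selection_mulmx_le _ (Py_selection P)))//.
  by rewrite opprB addrA subrK.
apply: (@closed_comp _ _ f [set x | x <= Delta]); last exact: closed_le.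
by move=> x _; exact: fc.
Qed.

(** The radius is such that delta is Lipschitz on the slab with a constant e
    that is small against both constants L1, L2 of strong regularity: against
    L2 so that the parameters are admissible, against 1 / L1 so that the
    solution map is a contraction. *)
Lemma wPLP_contraction what :
  strong_regularity P -> feasible P what ->
  exists2 Delta : R, 0 < Delta &
    (forall w, Py_slab P what Delta w ->
       plp_solutions P w what Delta (wPLP P w what Delta)) /\
    (forall w1 w2, Py_slab P what Delta w1 -> Py_slab P what Delta w2 ->
       `|wPLP P w1 what Delta - wPLP P w2 what Delta| <= 2^-1 * `|w1 - w2|).
Proof.
move=> /[apply] -[L1 [L2 [Dbar [L10 L20 Dbar0 reg]]]].
have [gd jd _] := gfun_C2 P.
(* The added 1 keeps k positive when ng = 0. *)
pose k : R := Num.sqrt ng%:R + 1.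
have k0 : 0 < k by rewrite ltr_pwDr// sqrtr_ge0.
pose e := Num.min (2^-1 / (L1 * k)) (L2 / k).
have e0 : 0 < e by rewrite lt_min !divr_gt0// mulr_gt0.
have e1 : L1 * (k * e) <= 2^-1.
  by rewrite mulrA mulrC -ler_pdivlMr ?mulr_gt0// ge_min lexx.
have e2 : k * e <= L2 by rewrite mulrC -ler_pdivlMr// ge_min lexx orbT.
have [rho rho0 strict] := jac_strictly_differentiable gd
  (differentiable_continuous (jd (Py P *m what))) e0.
pose Delta := Num.min rho Dbar.
have Delta0 : 0 < Delta by rewrite lt_min rho0.
have delta_le w1 w2 : Py_slab P what Delta w1 -> Py_slab P what Delta w2 ->
    enorm (delta P w1 what - delta P w2 what)
      <= k * e * `|Py P *m (w1 - w2)|.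
  rewrite /Py_slab/= !mulmxBr => s1 s2.
  rewrite delta_sub (le_trans (enorm_le_norm _))// -mulrA ler_pM ?sqrtr_ge0//.
    by rewrite lerDl.
  by apply: strict; [apply: le_trans s1 _|apply: le_trans s2 _];
     rewrite ge_min lexx.
have slab_what : Py_slab P what Delta what.
  by rewrite /Py_slab/= subrr mulmx0 normr0 ltW.
(* Both parameters are moved into the box, which changes neither delta nor the
   solution. *)
have sol w1 w2 : Py_slab P what Delta w1 -> Py_slab P what Delta w2 ->
    plp_solutions P w1 what Delta (wPLP P w1 what Delta) /\
    `|wPLP P w1 what Delta - wPLP P w2 what Delta| <= 2^-1 * `|w1 - w2|.
  move=> s1 s2.
  have small w : Py_slab P what Delta w -> enorm (delta P w what) <= L2 * Delta.
    move=> s; rewrite -[delta _ _ _]subr0 -(delta_self what).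
    by rewrite (le_trans (delta_le _ _ s slab_what))// ler_pM// ?mulr_ge0 ?ltW.
  have [v1 v1E v1B] := selection_truncate what w1 (Py_selection P).
  have [v2 v2E v2B] := selection_truncate what w2 (Py_selection P).
  have [d1 p1] := wPLP_Py what Delta v1E.
  have [d2 p2] := wPLP_Py what Delta v2E.
  have DD : Delta <= Dbar by rewrite ge_min lexx orbT.
  have := reg Delta v1 v2 Delta0 DD (le_trans v1B s1) (le_trans v2B s2).
  rewrite d1 d2 p1 p2 => /(_ (small _ s1) (small _ s2)) [[z1 z1P] _ lip].
  split.
    rewrite /wPLP; apply: (@xgetPex _ 0); exists z1; move: z1P.
    by rewrite /plp_solutions /plp_feasible d1.
  apply: le_trans (norm_le_enorm _) _; apply: le_trans lip _.
  apply: le_trans (ler_wpM2l (ltW L10) (delta_le _ _ s1 s2)) _; rewrite mulrA.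
  apply: le_trans (ler_wpM2r (normr_ge0 _) e1) _.
  by apply: ler_wpM2l => //; exact: selection_mulmx_le (Py_selection P).
exists Delta => //; split=> [w s|w1 w2 s1 s2]; first by case: (sol w w s s).
by case: (sol w1 w2 s1 s2).
Qed.

Lemma inner_iter_cvg what Delta :
  0 < Delta ->
  (forall w, Py_slab P what Delta w ->
     plp_solutions P w what Delta (wPLP P w what Delta)) ->
  (forall w1 w2, Py_slab P what Delta w1 -> Py_slab P what Delta w2 ->
     `|wPLP P w1 what Delta - wPLP P w2 what Delta| <= 2^-1 * `|w1 - w2|) ->
  exists wstar, [/\ inner_iter P what Delta l @[l --> \oo] --> wstar,
    Py_slab P what Delta wstar & wstar = wPLP P wstar what Delta].
Proof.
move=> Delta0 sol lip.
have stable : set_fun (Py_slab P what Delta) (Py_slab P what Delta)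
    (fun w => wPLP P w what Delta).
  by move=> w /sol[[]].
have slab_wbar : Py_slab P what Delta (wbar P what Delta).
  by apply: stable; rewrite /Py_slab/= subrr mulmx0 normr0 ltW.
have slab_iter n : Py_slab P what Delta (inner_iter P what Delta n).
  by elim: n => [|n IH]; [exact: slab_wbar|exact: stable IH].
pose f := mkfun stable.
have ctr : contraction (2^-1)%:nng f.
  split; first by rewrite /= invf_lt1// ltr1n.
  by case=> w1 w2 [/= s1 s2]; exact: lip.
have yE : (fun n => iter n f (wbar P what Delta)) =
    inner_iter P what Delta by [].
have slab_closed := @closed_Py_slab what Delta.
have cv := contraction_cvg ctr slab_wbar.
have fx := contraction_cvg_fixed ctr slab_wbar slab_closed.
rewrite yE in cv fx.
exists (limn (inner_iter P what Delta)); split.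
- exact: cv.
- apply: closed_cvg cv => //.
  by apply: nearW => n; exact: slab_iter.
- exact: fx.
Qed.

(** At a fixed point the correction delta(w) is exactly the linearization error
    in the equality constraint. *)
Lemma plp_fixed_point_feasible w what Delta :
  plp_feasible P w what Delta w -> feasible P w.
Proof.
case=> eq0 ineq _; split=> //; rewrite -[RHS]eq0.
by apply/matrixP => i j; rewrite /eq_residual /delta !mxE; lra.
Qed.

End InnerProblem.

(** * One Anderson step *)

(** Each interior index occurs in two adjacent pairs, the two extreme ones in a
    single pair. *)
Lemma sum_adjacent (R : numDomainType) (a : nat -> R) (d l : nat) :
  (d <= l)%N ->
  \sum_(0 <= j < d) (a (l - j)%N + a (l - j.+1)%N) =
  2 * (\sum_(l - d <= j < l.+1) a j) - a l - a (l - d)%N.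
Proof.
elim: d => [_|d IH dl]; first by rewrite big_geq// subn0 big_nat1; ring.
rewrite big_nat_recr//= IH 1?ltnW//.
rewrite [in RHS]big_ltn; last by lia.
rewrite (_ : (l - d.+1).+1 = l - d)%N; [ring|lia].
Qed.

(** For 0 < d, by [sum_adjacent], the weights on the left are 1 + D for the last
    term, 2 D for the interior ones and D for the first one. *)
Lemma anderson_weights_le (R : realDomainType) (a : nat -> R) (D : R)
    (d l : nat) :
  (forall j, 0 <= a j) -> 0 <= D -> (d <= l)%N ->
  a l + D * \sum_(0 <= j < d) (a (l - j)%N + a (l - j.+1)%N) <=
  Num.max (2 * D) (1 + D) * \sum_(l - d <= j < l.+1) a j.
Proof.
move=> a0 D0 dl; rewrite sum_adjacent//.
set S := \sum_(_ <= j < _) _.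
have alS : a l <= S.
  rewrite /S big_nat_recr//=; last exact: leq_subr.
  by rewrite lerDr sumr_ge0.
have S0 : 0 <= S by exact: sumr_ge0.
have := mulr_ge0 D0 (a0 (l - d)%N).
have [D1|D1] := leP 1 D.
- have := mulr_ge0 (a0 l) (_ : 0 <= D - 1).
  rewrite subr_ge0 => /(_ D1) h1 h2.
  apply: (@le_trans _ _ (2 * D * S)); first by nra.
  by rewrite ler_wpM2r// le_max lexx.
- have h := mulr_ge0 (_ : 0 <= S - a l) (_ : 0 <= 1 - D).
  rewrite !subr_ge0 in h; have {}h := h alS (ltW D1) => h2.
  apply: (@le_trans _ _ ((1 + D) * S)); first by nra.
  by rewrite ler_wpM2r// le_max lexx orbT.
Qed.

(** Column j of E + F is (w_(l-j) + r_(l-j+1)) - (w_(l-j-1) + r_(l-j)), so the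
    step only involves the points w_k + r_(k+1), whose distance to x is assumed
    to be controlled by that of w_k. *)
Lemma anderson_step_le (R : realType) (n d l : nat) (w r : nat -> 'cV[R]_n)
    (x : 'cV[R]_n) (q D : R) (gam : 'cV[R]_(minn l d)) :
  0 <= q -> 0 <= D -> (d <= l)%N -> `|gam| <= D ->
  (forall k, (k <= l)%N -> `|w k + r k.+1 - x| <= q * `|w k - x|) ->
  `|w l + r l.+1 - (Emx d w l + Fmx d r l) *m gam - x| <=
  q * (Num.max (2 * D) (1 + D) * \sum_(l - d <= j < l.+1) `|w j - x|).
Proof.
move=> q0 D0 dl gamD ctr.
apply: le_trans (ler_wpM2l q0
  (anderson_weights_le (fun j => normr_ge0 (w j - x)) D0 dl)).
apply: norm_le_coord => [|i o].
  by rewrite mulr_ge0// addr_ge0// mulr_ge0// sumr_ge0// => j _;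
    rewrite addr_ge0.
rewrite {o}ord1.
pose y k := w k + r k.+1 - x.
have -> : (w l + r l.+1 - (Emx d w l + Fmx d r l) *m gam - x) i 0 =
    y l i 0 - \sum_(j < minn l d) (y (l - j)%N - y (l - j.+1)%N) i 0 * gam j 0.
  rewrite /y !mxE -!addrA; congr (_ + (_ + _)).
  rewrite addrC; congr (_ - _); apply: eq_bigr => j _; rewrite !mxE.
  have -> : ((l - j.+1).+1 = l - j)%N by have := ltn_ord j; lia.
  by congr (_ * _); ring.
rewrite mulrDr (le_trans (ler_normB _ _))// lerD//.
  by rewrite (le_trans (ler_coord_norm _ _ _))// ctr.
rewrite (le_trans (ler_norm_sum _ _ _))//.
have dE : d = minn l d by exact/esym/minn_idPr.
rewrite [X in \sum_(0 <= _ < X) _]dE big_mkord.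
rewrite mulrCA !mulr_sumr; apply: ler_sum => j _.
rewrite normrM mulrC ler_pM//.
  by rewrite (le_trans (ler_coord_norm _ _ _)).
rewrite (le_trans (ler_coord_norm _ _ _))// (le_trans (ler_normB _ _))//.
by rewrite mulrDr lerD// ctr// leq_subr.
Qed.

(** The nearest point p of u is no further from u than x is; the triangle
    inequality does the rest. *)
Lemma is_proj_norm_le (R : realType) (n : nat) (S : set 'cV[R]_n)
    (u p x : 'cV[R]_n) :
  is_proj S u p -> S x -> `|p - x| <= (Num.sqrt n%:R + 1) * `|u - x|.
Proof.
move=> [_ pmin] Sx; rewrite mulrDl mul1r.
rewrite (le_trans (ler_distD u _ _))// lerD2r distrC.
exact: le_trans (norm_le_enorm _) (le_trans (pmin _ Sx) (enorm_le_norm _)).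
Qed.

(** * Runs of the accelerated iteration *)

Lemma produced_le (last : option nat) k l :
  (k <= l)%N -> produced last l -> produced last k.
Proof. by case: last => //= n; exact: leq_trans. Qed.

Section Run.
Context {R : realType} {nw nb ng ny : nat} (P : nlp R nw nb ng ny).
Context (what : 'cV[R]_nw) (Delta : R) (Delta0 : 0 < Delta).
Context (d : nat) (sigma : R) (last : option nat) (w r : nat -> 'cV[R]_nw).
Context (gam : forall l : nat, 'cV[R]_(minn l.-1 d)).
Context (run : aa_run P what Delta sigma last w r gam).

Lemma aa_run_plus_residual k : produced last k.+1 ->
  w k + r k.+1 = wPLP P (w k) what Delta.
Proof.
case: run => w0 w1 r1 _ res _ _; case: k => [_|k pk].
  by rewrite r1 addrC subrK w1 w0.
by rewrite res// addrC subrK.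
Qed.

(** The exception is [wbar], which is not projected. *)
Lemma aa_run_Binf k : k != 1%N -> produced last k -> Binf what Delta (w k).
Proof.
case: run => w0 _ _ _ _ _ upd; case: k => [|[//|k]] _ pk.
  by rewrite /Binf/= w0 subrr normr0 ltW.
by case: (upd k.+1 isT pk).
Qed.

Lemma aa_run_slab k :
  (forall v, Py_slab P what Delta v ->
     plp_solutions P v what Delta (wPLP P v what Delta)) ->
  produced last k -> Py_slab P what Delta (w k).
Proof.
move=> sol pk; have [->|k1] := eqVneq k 1%N.
  have /sol[[_ _ slab_wbar] _] : Py_slab P what Delta what.
    by rewrite /Py_slab/= subrr mulmx0 normr0 ltW.
  by rewrite (aa_w1 run).
exact/Binf_Py_slab/aa_run_Binf.
Qed.

Lemma aa_run_extrapolation (wstar : 'cV[R]_nw) (D : R) (l : nat) :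
  (forall v, Py_slab P what Delta v ->
     plp_solutions P v what Delta (wPLP P v what Delta)) ->
  (forall v, Py_slab P what Delta v ->
     `|wPLP P v what Delta - wstar| <= 2^-1 * `|v - wstar|) ->
  0 <= D -> (d <= l)%N -> produced last l.+1 -> `|gam l.+1| <= D ->
  `|w l + r l.+1 - (Emx d w l + Fmx d r l) *m gam l.+1 - wstar| <=
  2^-1 * (Num.max (2 * D) (1 + D) * \sum_(l - d <= j < l.+1) `|w j - wstar|).
Proof.
move=> sol ctr D0 dl pl gamD.
apply: anderson_step_le => // k kl.
rewrite aa_run_plus_residual; last exact: produced_le pl.
by apply: ctr; apply: aa_run_slab => //; apply: produced_le pl; exact: leqW.
Qed.

End Run.

(** * Linear convergence *)

Theorem theorem2 (R : realType) (nw nb ng ny : nat) (P : nlp R nw nb ng ny)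
    (Hreg : strong_regularity P)
    (what : 'cV[R]_nw) (Hfeas : feasible P what)
    (d : nat) (Hd : (1 <= d)%N) :
  exists (L Delta : R) (wstar : 'cV[R]_nw),
    [/\ 0 < L,
        0 < Delta,
        feasible P wstar,
        inner_iter P what Delta l @[l --> \oo] --> wstar &
        forall (sigma : R) (last : option nat) (w r : nat -> 'cV[R]_nw)
            (gam : forall l : nat, 'cV[R]_(minn l.-1 d)),
          0 < sigma -> sigma < 10%:R ^- 5 ->
          aa_run P what Delta sigma last w r gam ->
          forall D : R, 0 < D ->
            (forall l, (2 <= l)%N -> produced last l -> `|gam l| <= D) ->
            forall l, (d <= l)%N -> produced last l.+1 ->
              enorm (w l.+1 - wstar)
                <= L * Delta * Num.max (2 * D) (1 + D)
                   * \sum_(l - d <= j < l.+1) enorm (w j - wstar)].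
Proof.
have [Delta Delta0 [sol lip]] := wPLP_contraction Hreg Hfeas.
have [wstar [cv slab_wstar fix_wstar]] := inner_iter_cvg Delta0 sol lip.
have feas_wstar : feasible P wstar.
  apply: (@plp_fixed_point_feasible _ _ _ _ _ _ _ what Delta).
  by rewrite {2}fix_wstar; case: (sol _ slab_wstar).
have ctr v : Py_slab P what Delta v ->
    `|wPLP P v what Delta - wstar| <= 2^-1 * `|v - wstar|.
  by move=> sv; rewrite {1}fix_wstar; exact: lip.
pose k : R := Num.sqrt nw%:R + 1.
have k0 : 0 < k by rewrite ltr_pwDr// sqrtr_ge0.
have enorm_k (v : 'cV[R]_nw) : enorm v <= k * `|v|.
  by rewrite (le_trans (enorm_le_norm v))// ler_wpM2r// lerDl.
(* The radius is chosen before the factor, so that M / Delta can serve as L. *)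
suff [M M0 bound] : exists2 M : R, 0 < M &
    forall (sigma : R) (last : option nat) (w r : nat -> 'cV[R]_nw)
        (gam : forall l : nat, 'cV[R]_(minn l.-1 d)),
      aa_run P what Delta sigma last w r gam ->
    forall D, 0 < D ->
      (forall l, (2 <= l)%N -> produced last l -> `|gam l| <= D) ->
    forall l, (d <= l)%N -> produced last l.+1 ->
      enorm (w l.+1 - wstar) <= M * (Num.max (2 * D) (1 + D)
        * \sum_(l - d <= j < l.+1) `|w j - wstar|).
  exists (M / Delta), Delta, wstar; split => //; first exact: divr_gt0.
  move=> sigma last w r gam _ _ run D D0 gamD l dl pl.
  apply: le_trans (bound _ _ _ _ _ run D D0 gamD l dl pl) _.
  rewrite divfK ?gt_eqF// -mulrA ler_pM2l// ler_wpM2l//.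
    by rewrite le_max mulr_ge0 ?ler0n ?(ltW D0).
  by apply: ler_sum => j _; exact: norm_le_enorm.
have [in_box|out_box] := leP `|wstar - what| Delta.
(* One factor k comes from the projection, the other one from the passage to the
   Euclidean norm. *)
- exists (k * k); first exact: mulr_gt0.
  move=> sigma last w r gam run D D0 gamD l dl pl.
  have l0 : (1 <= l)%N by exact: leq_trans dl.
  have := aa_run_extrapolation Delta0 run sol ctr (ltW D0) dl pl
    (gamD l.+1 l0 pl).
  have := is_proj_norm_le (aa_update run l0 pl) in_box.
  rewrite -/k.
  set u := `|_ - _ *m _ - wstar|; set S := Num.max _ _ * _ => pu uS.
  have u0 : 0 <= u by exact: normr_ge0.
  rewrite (le_trans (enorm_k _))// -mulrA ler_pM2l//.
  by rewrite (le_trans pu)// ler_pM2l//; lra.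
(* The box keeps a distance e from wstar. *)
- pose e := `|wstar - what| - Delta.
  have e0 : 0 < e by rewrite subr_gt0.
  exists (k * (Delta + `|wstar - what|) / e).
    by rewrite divr_gt0// mulr_gt0// ltr_wpDr.
  move=> sigma last w r gam run D D0 gamD l dl pl.
  have l0 : (1 <= l)%N by exact: leq_trans dl.
  have near_what j : j != 1%N -> (j <= l.+1)%N -> `|w j - what| <= Delta.
    by move=> j1 jl; exact: (aa_run_Binf Delta0 run j1 (produced_le jl pl)).
  (* An index of the sum other than 1, since w 1 is not confined to the box: for
     l = 1 one has d = 1 and the sum contains the term of w 0 = what. *)
  have [j [j1 dj jl]] : exists j, [/\ j != 1, l - d <= j & j <= l]%N.
    by have [l1|l1] := eqVneq l 1%N; [exists 0%N|exists l]; split => //; lia.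
  have ej : e <= `|w j - wstar|.
    have := near_what _ j1 (leqW jl).
    have := ler_distD (w j) wstar what; rewrite [X in _ <= X + _]distrC /e.
    lra.
  have jS : `|w j - wstar| <= \sum_(l - d <= i < l.+1) `|w i - wstar|.
    rewrite (bigD1_seq j)/= ?iota_uniq//; last by rewrite mem_index_iota dj.
    by rewrite lerDl sumr_ge0.
  have D1 : 1 <= Num.max (2 * D) (1 + D) by rewrite le_max lerDl (ltW D0) orbT.
  rewrite (le_trans (enorm_k _))// -!mulrA ler_pM2l//.
  apply: le_trans (_ : Delta + `|wstar - what| <= _).
    rewrite (le_trans (ler_distD what _ _))// [X in _ + X]distrC lerD2r.
    by apply: near_what => //; lia.
  rewrite ler_peMr ?addr_ge0 ?(ltW Delta0)// mulrC ler_pdivlMr// mul1r.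
  rewrite (le_trans ej)// (le_trans jS)// ler_peMl//.
  exact: le_trans jS.
Qed.
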